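(* Let $n$ be an integer greater than $5$. If $\vartheta(A_n,3)\geq 3$, then $\delta(A_n)\geq\delta(A_{n-2})+4$.
   Context: Polygons are treated combinatorially: a convex polygon is a finite set of vertices with a clockwise cyclic order; edges are $2$-element vertex sets, two edges cross if disjoint with alternating vertices in the cyclic order; a triangulation is an inclusion-maximal set of pairwise non-crossing edges; a flip replaces an interior edge $\varepsilon$ of $T$ by the other diagonal of the unique quadrilateral with diagonal $\varepsilon$ and sides in $T$. For a pair $P=\{U,V\}$, $\delta(P)$ is the minimum number of flips transforming $U$ into $V$; a path realizing it is geodesic. For a vertex $a$ with clockwise successor $b$ and a triangulation $T$, $\mathrm{lk}_T(\{a,b\})$ is the unique vertex $x$ with $\{a,x\},\{b,x\}\in T$; a flip $T\to T'$ is incident to $\{a,b\}$ if the links differ; $\vartheta(P,a)$ is the maximum over geodesic paths between $U$ and $V$ of the number of flips incident to $\{a,b\}$. Deletion: for a vertex $a$ of a polygon with at least $4$ vertices, with clockwise successor $b$, $T\ominus a=\{\varepsilon \text{ with } a \text{ replaced by } b:\varepsilon\in T\setminus\{\{a,b\}\}\}$. Zigzag: for $N\geq 4$, on the polygon with vertices $0,\dots,N-1$ labeled clockwise (mod $N$), $Z_N$ is the triangulation whose interior edges are $\varepsilon_{2k+1}=\{2-k,4+k\}$ and $\varepsilon_{2k+2}=\{1-k,4+k\}$ ($k\geq0$), for indices $1,\dots,N-3$. In a polygon with $N$ vertices, $\bar k=k+\lfloor N/2\rfloor$. Pair $A_n$ ($n\geq3$): $A_n^-$ is $Z_{n+4}$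 with $0,1,\bar0,\bar1$ deleted successively ($\bar k=k+\lfloor (n+4)/2\rfloor$), remaining vertices relabeled clockwise $0,\dots,n-1$ with vertex $2$ keeping label $2$; $A_n^+$ is $Z_{n+4}$ with $4,5,\bar4,\bar5$ deleted successively, relabeled clockwise $0,\dots,n-1$ with former vertex $2$ getting label $1$. Both are triangulations of the polygon with vertices $0,\dots,n-1$; $A_n=\{A_n^-,A_n^+\}$. *)

(* Defs.v *)
From HB Require Import structures.
From mathcomp Require Import all_boot all_order all_fingroup all_algebra.

Set Implicit Arguments.
Unset Strict Implicit.
Unset Printing Implicit Defensive.

Import GRing.Theory.

(* A convex polygon is a duplicate-free sequence [s] listing its vertices in
   clockwise order, considered up to rotation; [next s a] is the clockwise
   successor of [a].  Edges are two-element sets of vertices.  Sets of edges,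
   in particular triangulations, include the boundary edges of the polygon. *)

Section Polygon.

Variables (T : finType) (s : seq T).

Implicit Types (a b c d x : T) (e f : {set T}) (E U V : {set {set T}}).

Definition clockwise a b c d : bool :=
  has (fun i => subseq [:: a; b; c; d] (rot i s)) (iota 0 (size s)).

Definition is_edge e : bool := (#|e| == 2) && (e \subset s).

Definition crossing e f : bool :=
  [exists a, exists b, exists c, exists d,
    [&& e == [set a; c], f == [set b; d] & clockwise a b c d]].

Definition noncrossing E : bool :=
  [forall e in E, is_edge e] && [forall e in E, forall f in E, ~~ crossing e f].

Definition triangulation U : bool := maxset noncrossing U.

(* Here [a, b, c, d] is the quadrilateral whose sides belong to [U]; its
   diagonal [{a, c}] is exchanged for the other diagonal [{b, d}]. *)
Definition flip U V : bool :=
  triangulation U &&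
  [exists a, exists b, exists c, exists d,
    [&& clockwise a b c d,
        [set a; b] \in U, [set b; c] \in U, [set c; d] \in U, [set d; a] \in U,
        [set a; c] \in U & V == [set b; d] |: (U :\ [set a; c])]].

Definition flip_path k U V (p : k.-tuple {set {set T}}) : bool :=
  path flip U p && (last U p == V).

Lemma connect_flip_path U V :
  connect flip U V -> exists k, [exists p : k.-tuple _, flip_path U V p].
Proof.
case/connectP=> p Up ->; exists (size p); apply/existsP; exists (in_tuple p).
by rewrite /flip_path Up eqxx.
Qed.

(* The value 0 given to pairs that no sequence of flips connects is a dummy:
   any two triangulations of a convex polygon are connected by flips. *)
Definition delta (P : {set {set T}} * {set {set T}}) : nat :=
  if @idP (connect flip P.1 P.2) is ReflectT UV
  then ex_minn (connect_flip_path UV) else 0.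

(* [lk a U] is the link in [U] of the boundary edge [{a, next s a}]. *)
Definition lk a U : option T :=
  [pick x in s | ([set a; x] \in U) && ([set next s a; x] \in U)].

Definition incident a U V : bool := lk a U != lk a V.

Definition theta (P : {set {set T}} * {set {set T}}) a : nat :=
  \max_(p : (delta P).-tuple {set {set T}} | flip_path P.1 P.2 p)
    count id (pairmap (incident a) P.1 p).

Definition boundary : {set {set T}} := [set [set a; next s a] | a in s].

Definition deletion U a : {set {set T}} :=
  [set [set (if x == a then next s a else x) | x in e]
     | e : {set T} in U :\ [set a; next s a]].

End Polygon.

Definition delete_vertex (T : finType) (sU : seq T * {set {set T}}) (a : T) :=
  (rem a sU.1, deletion sU.1 sU.2 a).

(* The polygon with vertices 0, ..., N-1 labeled clockwise. *)
Definition polygon (N : nat) : seq 'I_N := enum 'I_N.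

(* Below, N = n.+4, and arithmetic on vertex labels modulo N is that of the
   ring structure of ['I_n.+4]. *)

(* [zigzag_edge n i] is epsilon_i; both i = 2k+1 and i = 2k+2 give
   k = i.-1./2. *)
Definition zigzag_edge (n i : nat) : {set 'I_n.+4} :=
  let k : 'I_n.+4 := (i.-1./2)%:R%R in
  ([set (if odd i then 2%:R else 1) - k; 4%:R + k])%R.

Definition zigzag (n : nat) : {set {set 'I_n.+4}} :=
  boundary (polygon n.+4) :|: [set zigzag_edge n i.+1 | i : 'I_n.+1].

Definition bar (n : nat) (k : 'I_n.+4) : 'I_n.+4 := (k + (n.+4)./2%:R)%R.

(* Relabeling of [sU] by 0, ..., n-1 clockwise, where the polygon [sU.1] has n
   vertices and its vertex [v] gets the label [l] (with l <= n): the vertex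
   labeled [j] is then reached from [v] in n + j - l clockwise steps. *)
Definition relabel (n : nat) (T : finType) (sU : seq T * {set {set T}})
    (v : T) (l : nat) : {set {set 'I_n}} :=
  [set e : {set 'I_n} |
    [set iter (n + j - l) (next sU.1) v | j : 'I_n in e] \in sU.2].

(* Meaningful for 3 <= n only. *)
Definition A_minus (n : nat) : {set {set 'I_n}} :=
  relabel n
    (foldl (@delete_vertex 'I_n.+4) (polygon n.+4, zigzag n)
       [:: 0; 1; bar 0; bar 1]%R)
    2%:R%R 2.

Definition A_plus (n : nat) : {set {set 'I_n}} :=
  relabel n
    (foldl (@delete_vertex 'I_n.+4) (polygon n.+4, zigzag n)
       [:: 4%:R; 5%:R; bar 4%:R; bar 5%:R]%R)
    2%:R%R 1.

Definition A (n : nat) := (A_minus n, A_plus n).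

(* Main.v *)
Require Import Defs.
From mathcomp Require Import all_boot all_order all_fingroup all_algebra.
From mathcomp Require Import zify.

Set Implicit Arguments.
Unset Strict Implicit.
Unset Printing Implicit Defensive.

(* Contracting a boundary edge {a, b} of the polygon maps triangulations to
   triangulations and every flip either to a flip or to the identity, the
   latter whenever the flip is incident to {a, b}.  A geodesic from A_n^- to
   A_n^+ with three flips incident to {3, 4} therefore loses at least three
   flips when {3, 4} is contracted.  In the contracted pair the links of {1, 2}
   differ, so contracting {1, 2} as well loses at least one more flip, and the
   resulting pair is A_{n-2} up to the labeling of the vertices.

   All contractions, including the deletions and relabelings that define A_n^-
   and A_n^+ from a zigzag, are images of a set of edges under a map of the
   vertices.  Two vertices x, y of the polygon with N vertices form an edge of
   the zigzag iff they are adjacent or x + y is 5 or 6 modulo N, so the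
   identity between the images of two zigzags is linear arithmetic. *)

(** * Cyclic order read off from positions in a sequence *)

Definition cyc (i j k l : nat) : bool :=
  [|| [&& i < j, j < k & k < l], [&& j < k, k < l & l < i],
      [&& k < l, l < i & i < j] | [&& l < i, i < j & j < k]].

(** This turns [clockwise], a condition on rotations of the vertex list, into inequalities between
    positions, which [lia] can decide. *)
Lemma subseq_index (T : eqType) (t s : seq T) : uniq s ->
  subseq t s = all (mem s) t && sorted ltn [seq index x s | x <- t].
Proof.
elim: s t => [|y s IHs] [|x t] //= /andP[ys us].
have sub u : all (mem s) u ->
    [seq index z (y :: s) | z <- u] = [seq (index z s).+1 | z <- u].
  by move/allP=> au; apply/eq_in_map => z /au /= zs; case: eqP ys => // ->;
    rewrite zs.
have shift i u : path ltn i.+1 [seq (index z s).+1 | z <- u] =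
                 path ltn i [seq index z s | z <- u].
  by elim: u i => //= z u IHu i; rewrite IHu ltnS.
have shift0 u : path ltn 0 [seq (index z s).+1 | z <- u] =
                 sorted ltn [seq index z s | z <- u].
  by case: u => //= z u; rewrite shift.
have ty u i : path ltn i [seq index z (y :: s) | z <- u] -> y \notin u.
  elim: u i => //= z u IHu i; rewrite inE negb_or.
  by case: eqP => /= [_|_ /andP[_ /IHu]].
have am u : y \notin u -> all (mem (y :: s)) u = all (mem s) u.
  move=> yu; apply: eq_in_all => z zu /=; rewrite inE.
  by case: eqP zu yu => // -> ->.
rewrite /= !inE /=; case: (eqVneq x y) => [->|xy] /=.
  rewrite IHs //; apply/andP/andP=> [[a1 a2]|[a1 a2]].
    split; first by apply: sub_all a1 => z /= zs; rewrite inE zs orbT.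
    by rewrite sub // shift0.
  have yt := ty _ _ a2; move: a1; rewrite am // => a1; split=> //.
  by move: a2; rewrite sub // shift0.
rewrite IHs //=.
have [xs|] //= := boolP (x \in s).
apply/andP/andP=> [[a1 a2]|[a1 a2]].
  split; first by apply: sub_all a1 => z /= zs; rewrite inE zs orbT.
  by rewrite sub // shift.
have yt := ty _ _ a2; move: a1; rewrite am // => a1; split=> //.
by move: a2; rewrite sub // shift.
Qed.

Lemma index_rot (T : eqType) (s : seq T) (i : nat) (x : T) :
  uniq s -> x \in s -> i <= size s -> index x (rot i s) =
  if i <= index x s then index x s - i else index x s + (size s - i).
Proof.
move=> us xs le_i; have: x \in take i s ++ drop i s by rewrite cat_take_drop.
have ud : uniq (take i s ++ drop i s) by rewrite cat_take_drop.
have st : size (take i s) = i by rewrite size_takel.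
rewrite -[in index x s](cat_take_drop i s) -[in size s](cat_take_drop i s).
rewrite mem_cat /rot !index_cat size_cat st.
move: ud; rewrite cat_uniq => /and3P[_ /hasPn dis _].
have [xt|xt] /= := boolP (x \in take i s).
  move=> _; have ->: (x \in drop i s) = false.
    by apply: contraTF xt => /dis.
  have := xt; rewrite -index_mem st => lt; rewrite leqNgt lt /=; lia.
by move=> ->; rewrite leq_addr; lia.
Qed.

Lemma has_subseq_rot (T : eqType) (s : seq T) (a b c d : T) : uniq s ->
  has (fun i => subseq [:: a; b; c; d] (rot i s)) (iota 0 (size s)) =
  all (mem s) [:: a; b; c; d] &&
    cyc (index a s) (index b s) (index c s) (index d s).
Proof.
move=> us; have sr i : uniq (rot i s) by rewrite rot_uniq.
apply/hasP/andP=> [[i]|[al cy]].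
  rewrite mem_iota add0n => /andP[_ lti]; rewrite subseq_index //.
  rewrite /= !mem_rot !andbT => /andP[/and4P[ha hb hc hd]].
  rewrite ha hb hc hd !index_rot ?(ltnW lti) // => h; split=> //.
  move: ha hb hc hd h; rewrite -!index_mem /cyc.
  by do ![case: ifP => ?]; lia.
move: (al); rewrite /= andbT => /and4P[ha hb hc hd].
have aux i : i < size s ->
    sorted ltn [seq index x (rot i s) | x <- [:: a; b; c; d]] ->
   exists2 i0, i0 \in iota 0 (size s) & subseq [:: a; b; c; d] (rot i0 s).
  move=> lti h; exists i; first by rewrite mem_iota.
  by rewrite subseq_index // h /= !mem_rot ha hb hc hd.
have [ia ib ic id] : [/\ index a s < size s, index b s < size s,
  index c s < size s & index d s < size s].
  by rewrite !index_mem.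
case/or4P: cy => /and3P[h1 h2 h3].
(* Positions that already increase need no rotation; in the other three cases the rotation starts at
   [a]. *)
- by apply: (aux 0); [lia | rewrite rot0 /=; lia].
- apply: (aux (index a s)) => //=; rewrite !index_rot ?(ltnW ia) //.
  by do ![case: ifP => ?]; lia.
- apply: (aux (index a s)) => //=; rewrite !index_rot ?(ltnW ia) //.
  by do ![case: ifP => ?]; lia.
- apply: (aux (index a s)) => //=; rewrite !index_rot ?(ltnW ia) //.
  by do ![case: ifP => ?]; lia.
Qed.

Lemma clockwiseE (T : finType) (s : seq T) (a b c d : T) : uniq s ->
  clockwise s a b c d =
  all (mem s) [:: a; b; c; d] &&
    cyc (index a s) (index b s) (index c s) (index d s).
Proof. exact: has_subseq_rot. Qed.

(** * The polygon with vertices 0, ..., N-1 *)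

Lemma mem_polygon N (x : 'I_N) : x \in polygon N.
Proof. by rewrite mem_enum. Qed.

Lemma polygon_uniq N : uniq (polygon N).
Proof. exact: enum_uniq. Qed.

Lemma clockwise_polygon N (a b c d : 'I_N) :
  clockwise (polygon N) a b c d = cyc a b c d.
Proof.
by rewrite clockwiseE ?polygon_uniq //= !index_enum_ord !mem_polygon.
Qed.

Lemma next_polygon N (x : 'I_N) :
  next (polygon N) x = (if x.+1 < N then x.+1 else 0) :> nat.
Proof.
rewrite next_nth mem_polygon.
case E: (polygon N) (mem_polygon x) => [//|y p] _.
have sp : size p = N.-1.
  by have := size_enum_ord N; rewrite -/(polygon N) E /=; lia.
have y0 : y = 0 :> nat.
  by have := nth_enum_ord x (leq_ltn_trans (leq0n x) (ltn_ord x));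
    rewrite -/(polygon N) E.
have -> : index x (y :: p) = x by rewrite -E index_enum_ord.
case: ifP => h; last by rewrite nth_default // sp; have := ltn_ord x; lia.
have := nth_enum_ord y h; rewrite -/(polygon N) E /= => <-; congr nat_of_ord.
Qed.

(** * Unordered pairs and images of edge sets under vertex maps *)

Lemma set2_eq (T : finType) (x y u v : T) : [set x; y] = [set u; v] ->
  x = u /\ y = v \/ x = v /\ y = u.
Proof.
move=> E; have: x \in [set u; v] by rewrite -E set21.
have: y \in [set u; v] by rewrite -E set22.
have: u \in [set x; y] by rewrite E set21.
have: v \in [set x; y] by rewrite E set22.
by rewrite !inE => /orP[]/eqP ? /orP[]/eqP ? /orP[]/eqP ? /orP[]/eqP ?; subst;
  auto.
Qed.

Definition edge_image (T T' : finType) (g : T -> T') (E : {set {set T}}) :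
    {set {set T'}} :=
  [set [set g p.1; g p.2] | p : T * T &
     ([set p.1; p.2] \in E) && (g p.1 != g p.2)].

Section EdgeImage.

Variables (T T' : finType) (g : T -> T').
Implicit Types E : {set {set T}}.

Lemma edge_imageP E e :
  reflect (exists x y, [/\ [set x; y] \in E, g x != g y & e = [set g x; g y]])
          (e \in edge_image g E).
Proof.
apply: (iffP imsetP) => [[[x y]]|[x [y [xyE gxy ->]]]].
  by rewrite inE /= => /andP[] ? ? ->; exists x, y.
by exists (x, y); rewrite // inE xyE.
Qed.

Lemma mem_edge_image E x y :
  [set x; y] \in E -> g x != g y -> [set g x; g y] \in edge_image g E.
Proof. by move=> ? ?; apply/edge_imageP; exists x, y. Qed.

Lemma edge_image_pair E u v : [set u; v] \in edge_image g E ->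
  exists x y, [/\ [set x; y] \in E, g x = u, g y = v & u != v].
Proof.
case/edge_imageP=> x [y [xyE gxy /set2_eq[][-> ->]]]; first by exists x, y.
by exists y, x; rewrite setUC eq_sym.
Qed.

Lemma edge_imageU E E' :
  edge_image g (E :|: E') = edge_image g E :|: edge_image g E'.
Proof.
apply/setP=> e; rewrite inE; apply/edge_imageP/orP.
  by case=> x [y [+ ? ->]]; rewrite inE => /orP[]; [left|right];
    apply: mem_edge_image.
by case=> /edge_imageP[x [y [? ? ->]]]; exists x, y; split=> //; rewrite inE;
  apply/orP; auto.
Qed.

Lemma edge_image1 x y : g x != g y ->
  edge_image g [set [set x; y]] = [set [set g x; g y]].
Proof.
move=> gxy; apply/setP=> e; rewrite inE; apply/edge_imageP/eqP=> [|->].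
  by case=> u [v [/set1P/set2_eq[][-> ->] _ ->]] //; rewrite setUC.
by exists x, y; rewrite inE.
Qed.

End EdgeImage.

Lemma edge_image_comp (T1 T2 T3 : finType) (g : T2 -> T3) (f : T1 -> T2) E :
  edge_image g (edge_image f E) = edge_image (g \o f) E.
Proof.
apply/setP=> e; apply/edge_imageP/edge_imageP.
  case=> x [y [/edge_image_pair[u [v [uvE <- <- _]]] gxy ->]].
  by exists u, v.
case=> x [y [xyE gxy ->]]; exists (f x), (f y); split=> //.
by apply: mem_edge_image => //; apply: contraNneq gxy => /= ->.
Qed.

Lemma eq_edge_image (T T' : finType) (f g : T -> T') E :
  f =1 g -> edge_image f E = edge_image g E.
Proof.
move=> fg; apply/setP=> e.
by apply/edge_imageP/edge_imageP=> -[x [y [? gxy ->]]]; exists x, y;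
  rewrite ?fg // -!fg.
Qed.

(** * Triangulations in terms of cyclic order *)

Lemma crossing_polygon N (x y u v : 'I_N) :
  crossing (polygon N) [set x; y] [set u; v] = cyc x u y v || cyc x v y u.
Proof.
apply/existsP/idP=> [[a] /existsP[b] /existsP[c] /existsP[d]|].
  case/and3P=> /eqP/set2_eq[][-> ->] /eqP/set2_eq[][-> ->];
    by rewrite clockwise_polygon /cyc; lia.
case/orP=> h; [exists x; apply/existsP; exists u; apply/existsP; exists y;
  apply/existsP; exists v | exists x; apply/existsP; exists v; apply/existsP;
  exists y; apply/existsP; exists u];
    by rewrite clockwise_polygon h eqxx ?[[set v; u]]setUC eqxx.
Qed.

(** Maximality becomes the third clause: a pair outside [U] that no edge of [U] crosses could be
    added to [U]. The single orientation [cyc x u y v] suffices because [u] and [v] can be exchanged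
    in [[set u; v]]. *)
Lemma triangulationP N (U : {set {set 'I_N}}) :
  reflect [/\ forall e, e \in U -> #|e| = 2,
      forall x y u v : 'I_N, [set x; y] \in U -> [set u; v] \in U ->
        ~~ cyc x u y v
    & forall x y : 'I_N, x != y -> [set x; y] \notin U ->
        exists u v : 'I_N, [set u; v] \in U /\ cyc x u y v]
    (triangulation (polygon N) U).
Proof.
have edgeE (e : {set 'I_N}) : is_edge (polygon N) e = (#|e| == 2).
  by rewrite /is_edge andb_idr // => _; apply/subsetP=> x _; apply: mem_polygon.
have ncP (E : {set {set 'I_N}}) : reflect ((forall e, e \in E -> #|e| = 2) /\
    forall x y u v : 'I_N, [set x; y] \in E -> [set u; v] \in E ->
      ~~ cyc x u y v)
    (noncrossing (polygon N) E).
  apply: (iffP andP) => -[h1 h2]; split.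
  - by move=> e /(forall_inP h1); rewrite edgeE => /eqP.
  - move=> x y u v /(forall_inP h2) h /(forall_inP h).
    by rewrite crossing_polygon negb_or => /andP[].
  - by apply/forall_inP=> e /h1; rewrite edgeE => ->.
  apply/forall_inP=> e eE; apply/forall_inP=> f fE.
  have /eqP/cards2P[x [y [_ ex]]] := h1 _ eE.
  have /eqP/cards2P[u [v [_ fu]]] := h1 _ fE.
  subst e f; rewrite crossing_polygon negb_or (h2 _ _ _ _ eE fE) h2 //.
  by rewrite setUC.
apply: (iffP maxsetP) => [[/ncP[h1 h2] h3]|[h1 h2 h3]]; split=> //.
- move=> x y xy.
  case: (boolP [exists u, exists v, ([set u; v] \in U) && cyc x u y v]).
    by case/existsP=> u /existsP[v /andP[? ?]] _; exists u, v.
  (* Maximality is applied to [U] enlarged by the uncrossed pair. *)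
  move=> ne /negP[]; suff <- : [set x; y] |: U = U by rewrite setU11.
  have nc u v : [set u; v] \in U -> ~~ cyc x u y v.
    move=> uv; apply: contra ne => h.
    by apply/existsP; exists u; apply/existsP; exists v; rewrite uv.
  apply: h3; last exact: subsetU1.
  apply/ncP; split=> [e|u v z t].
    by rewrite !inE => /orP[/eqP->|/h1//]; rewrite cards2 xy.
  rewrite !inE => /orP[/eqP/set2_eq[][-> ->]|uv] /orP[/eqP/set2_eq[][-> ->]|zt];
    try by [rewrite /cyc; lia | exact: nc | exact: h2].
  - by have := nc t z; rewrite setUC => /(_ zt); rewrite /cyc; lia.
  - by have := nc v u; rewrite setUC => /(_ uv); rewrite /cyc; lia.
  by have := nc u v uv; rewrite /cyc; lia.
- by apply/ncP.
move=> E /ncP[k1 k2] sUE; apply/eqP; rewrite eqEsubset sUE andbT.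
apply/subsetP=> e eE; have /eqP/cards2P[x [y [xy ex]]] := k1 _ eE; subst e.
apply: contraT => /(h3 _ _ xy)[u [v [uvU]]].
by rewrite (negbTE (k2 _ _ _ _ eE (subsetP sUE _ uvU))).
Qed.

(** * Contraction of a boundary edge *)

Lemma cyc_rot i j k l : cyc i j k l = cyc j k l i.
Proof. by rewrite /cyc; lia. Qed.

Lemma cyc_neq i j k l : cyc i j k l ->
  [/\ i != j, i != k & i != l] /\ [/\ j != k, j != l & k != l].
Proof. by rewrite /cyc => h; do !split; lia. Qed.

Section Contraction.

Variables (n : nat) (g : 'I_n.+1 -> 'I_n) (a b : 'I_n.+1).
Hypothesis n_gt1 : 1 < n.
Hypothesis next_a : next (polygon n.+1) a = b.
Hypothesis g_ab : g a = g b.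
Hypothesis g_inj : forall x y, g x = g y ->
  [\/ x = y, x = a /\ y = b | x = b /\ y = a].
Hypothesis g_surj : forall z, exists x, g x = z.
Hypothesis g_cyc : forall x y z t, cyc (g x) (g y) (g z) (g t) -> cyc x y z t.
Hypothesis cyc_g : forall x y z t : 'I_n.+1, cyc x y z t ->
  ~~ ((a \in [:: x; y; z; t]) && (b \in [:: x; y; z; t])) ->
  cyc (g x) (g y) (g z) (g t).

Let val_b : b = (if a.+1 < n.+1 then a.+1 else 0) :> nat.
Proof. by rewrite -next_a next_polygon. Qed.

Let neq_ab : a != b.
Proof. by rewrite -val_eqE /= val_b; case: ifP; lia. Qed.

Let cyc_ab (x y : 'I_n.+1) : cyc a x y b = false.
Proof.
rewrite /cyc val_b; have := ltn_ord x; have := ltn_ord y; have := ltn_ord a.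
by case: ifP; lia.
Qed.

Let cyc_a_b (x y : 'I_n.+1) : cyc a x b y = false.
Proof.
rewrite /cyc val_b; have := ltn_ord x; have := ltn_ord y; have := ltn_ord a.
by case: ifP; lia.
Qed.

(** A crossing in the image lifts to a crossing in [U] by [g_cyc]. For maximality, a missing pair
    lifts to a missing pair, which an edge of [U] crosses; by [cyc_g] the crossing survives unless
    both [a] and [b] are among the four ends. *)
Lemma triangulation_contraction U :
  triangulation (polygon n.+1) U -> triangulation (polygon n) (edge_image g U).
Proof.
case/triangulationP=> U1 U2 U3; apply/triangulationP; split.
- by move=> e /edge_imageP[x [y [_ gxy ->]]]; rewrite cards2 gxy.
- move=> x y u v /edge_image_pair[x' [y' [xyU <- <- _]]].
  move=> /edge_image_pair[u' [v' [uvU <- <- _]]].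
  by apply: contra (U2 _ _ _ _ xyU uvU); apply: g_cyc.
have mem (u v : 'I_n.+1) : [set u; v] \in U ->
    forall z t, cyc z (g u) t (g v) -> [set g u; g v] \in edge_image g U.
  move=> uv z t h; apply: mem_edge_image => //.
  by apply: contraL h => /eqP->; rewrite /cyc; lia.
have contr (x y u v : 'I_n.+1) : [set u; v] \in U -> cyc x u y v ->
    ~~ ((a \in [:: x; u; y; v]) && (b \in [:: x; u; y; v])) ->
    exists u v : 'I_n, [set u; v] \in edge_image g U /\ cyc (g x) u (g y) v.
  by move=> uv h hab; have h' := cyc_g h hab; exists (g u), (g v); split=> //;
    apply: mem h'.
(* The vertex [g a] has two lifts, so [[set a; y]] and [[set b; y]] are both missing from [U], and
   each is crossed by an edge of [U]. At least one of these crossings survives. *)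
have at_a (y : 'I_n.+1) : g y != g a -> [set g a; g y] \notin edge_image g U ->
    exists u v : 'I_n, [set u; v] \in edge_image g U /\ cyc (g a) u (g y) v.
  move=> gya nay; have ya : y != a by apply: contraNneq gya => ->.
  have yb : y != b by apply: contraNneq gya => ->; rewrite g_ab.
  have [||u [v [uvU cuv]]] := U3 a y; first by rewrite eq_sym.
    by apply: contra nay => h; apply: mem_edge_image; rewrite // eq_sym.
  have [||u' [v' [uvU' cuv']]] := U3 b y; first by rewrite eq_sym.
    apply: contra nay => h; rewrite g_ab; apply: mem_edge_image => //.
    by rewrite -g_ab eq_sym.
  have [|] := boolP (~~ ((a \in [:: a; u; y; v]) && (b \in [:: a; u; y; v]))).
    exact: contr.
  have [/contr|] :=
    boolP (~~ ((a \in [:: b; u'; y; v']) && (b \in [:: b; u'; y; v']))).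
    by rewrite g_ab => H _; apply: H.
  rewrite !negbK !inE !eqxx ![_ == y]eq_sym [b == a]eq_sym.
  rewrite (negbTE ya) (negbTE yb) (negbTE neq_ab) /= andbT.
  case/orP=> [/eqP au|/eqP av].
    by move: cuv'; rewrite -au cyc_rot cyc_ab.
  case/orP=> [/eqP bu|/eqP bv]; last by move: cuv; rewrite -bv cyc_ab.
  (* If neither crossing survives, the clockwise order is [a], [b], [u'], [y], [v], and the two
     crossing edges [[set b; v]] and [[set u'; a]] of [U] cross each other. *)
  subst v' u; case/negP: (U2 _ _ _ _ uvU uvU').
  move: cuv cuv'; rewrite /cyc val_b; have := ltn_ord y; have := ltn_ord a.
  by have := ltn_ord u'; have := ltn_ord v; case: ifP; lia.
move=> x' y' xy' nxy'; have [x gx] := g_surj x'; have [y gy] := g_surj y'.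
subst x' y'.
have [gxa|gxa] := eqVneq (g x) (g a).
  by rewrite gxa; apply: at_a; rewrite -?gxa // eq_sym.
have [gya|gya] := eqVneq (g y) (g a).
  rewrite gya; have [||u [v [? h]]] := at_a x; rewrite -?gya 1?setUC //.
  exists v, u; split; first by rewrite setUC.
  by move: h; rewrite gya /cyc; lia.
have [||u [v [uvU cuv]]] := U3 x y; first by apply: contraNneq xy' => ->.
  by apply: contra nxy' => h; apply: mem_edge_image.
apply: (contr _ _ u v) => //.
have xa : x != a by apply: contraNneq gxa => ->.
have xb : x != b by apply: contraNneq gxa => ->; rewrite g_ab.
have ya : y != a by apply: contraNneq gya => ->.
have yb : y != b by apply: contraNneq gya => ->; rewrite g_ab.
rewrite !inE ![_ == x]eq_sym ![_ == y]eq_sym.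
rewrite !(negbTE xa, negbTE xb, negbTE ya, negbTE yb) /=.
(* As [x] and [y] differ from [a] and [b], the crossing edge would be the boundary edge from [a] to
   [b], which crosses nothing. *)
apply/negP=> /andP[/orP[]/eqP au /orP[]/eqP bv].
- by move: neq_ab; rewrite au bv eqxx.
- by move: cuv; rewrite -au -bv cyc_rot cyc_a_b.
- by move: cuv; rewrite -au -bv cyc_rot cyc_rot cyc_rot cyc_a_b.
by move: neq_ab; rewrite au bv eqxx.
Qed.

Section Flip.

Variable U : {set {set 'I_n.+1}}.
Hypothesis triU : triangulation (polygon n.+1) U.

Let U_nc (x y u v : 'I_n.+1) : [set x; y] \in U -> [set u; v] \in U ->
  ~~ cyc x u y v.
Proof. by have /triangulationP[_ U2 _] := triU; apply: U2. Qed.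

(* Otherwise the other of the two edges at [x] crosses a side of the
   quadrilateral. *)
Lemma quad_diagonal_link (p q r t x : 'I_n.+1) : cyc p q r t ->
  [set p; q] \in U -> [set q; r] \in U ->
  [set r; t] \in U -> [set t; p] \in U ->
  ~~ ((a \in [:: p; q; r; t]) && (b \in [:: p; q; r; t])) ->
  ([set a; x] \in U -> [set b; x] != [set p; r]) /\
  ([set b; x] \in U -> [set a; x] != [set p; r]).
Proof.
move=> c pq qr rt tp nab.
have [la lp lq] := And3 (ltn_ord a) (ltn_ord p) (ltn_ord q).
have [lr lt] := conj (ltn_ord r) (ltn_ord t).
split=> xU; apply/eqP=> /set2_eq[][E1 E2]; subst p r;
  move: nab; rewrite !inE eqxx ?orbT ?andbT /= !negb_or -!val_eqE => nab.
- by case/negP: (U_nc tp xU); move: c la lp lq lr lt nab;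
    rewrite /cyc /= val_b; case: ifP; lia.
- by case/negP: (U_nc qr xU); move: c la lp lq lr lt nab;
    rewrite /cyc /= val_b; case: ifP; lia.
- by case/negP: (U_nc pq xU); move: c la lp lq lr lt nab;
    rewrite /cyc /= val_b; case: ifP; lia.
- by case/negP: (U_nc rt xU); move: c la lp lq lr lt nab;
    rewrite /cyc /= val_b; case: ifP; lia.
Qed.

(** The quadrilateral of the flip decides. If it misses [a] or [b], its image is again a
    quadrilateral and the flip survives. If it contains both, they are consecutive corners, each
    diagonal acquires the same image as a side, and the images of [U] and [V] coincide. *)
Lemma flip_contraction V : flip (polygon n.+1) U V ->
  edge_image g V = edge_image g U \/
  flip (polygon n) (edge_image g U) (edge_image g V) /\
    ~~ incident (polygon n.+1) a U V.
Proof.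
case/andP=> _ /existsP[p] /existsP[q] /existsP[r] /existsP[t].
rewrite clockwise_polygon; case/and5P=> c pq qr rt /and3P[tp pr /eqP defV].
have [[npq npr npt] [nqr nqt nrt]] := cyc_neq c.
rewrite !val_eqE in npq npr npt nqr nqt nrt.
pose W := U :\ [set p; r].
have set2_neq (x y u v : 'I_n.+1) :
    ((x == u) && (y == v)) || ((x == v) && (y == u)) = false ->
    [set x; y] != [set u; v].
  by move=> h; apply/eqP=> /set2_eq[][E1 E2]; move: h;
    rewrite E1 E2 !eqxx ?orbT.
have nab : a == b = false := negbTE neq_ab.
have [Wpq Wqr Wrt Wtp] : [/\ [set p; q] \in W, [set q; r] \in W,
    [set r; t] \in W & [set t; p] \in W].
  rewrite !inE pq qr rt tp !andbT; split; apply: set2_neq;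
    rewrite ?eqxx ?[q == p]eq_sym ?[t == r]eq_sym ?[t == p]eq_sym
      ?[r == p]eq_sym ?[r == q]eq_sym;
    by rewrite ?(negbTE npq) ?(negbTE npr) ?(negbTE npt) ?(negbTE nqr)
      ?(negbTE nqt) ?(negbTE nrt).
have defU : U = [set p; r] |: W by rewrite setD1K.
have [] := boolP ((a \in [:: p; q; r; t]) && (b \in [:: p; q; r; t]));
  last first.
  move=> quad; right.
  have inj x y : x != y -> x \in [:: p; q; r; t] -> y \in [:: p; q; r; t] ->
      g x != g y.
    move=> xy xq yq; apply/eqP=> /g_inj[exy|[xa yb]|[xb ya]].
    - by rewrite exy eqxx in xy.
    - by rewrite -xa -yb xq yq in quad.
    by rewrite -xb -ya xq yq in quad.
  have mp : p \in [:: p; q; r; t] by rewrite inE eqxx.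
  have mq : q \in [:: p; q; r; t] by rewrite !inE eqxx ?orbT.
  have mr : r \in [:: p; q; r; t] by rewrite !inE eqxx ?orbT.
  have mt : t \in [:: p; q; r; t] by rewrite !inE eqxx ?orbT.
  have quad' : ~~ ((a \in [:: q; r; t; p]) && (b \in [:: q; r; t; p])).
    by rewrite !(mem_rot 1 [:: p; q; r; t]).
  have lpr x := quad_diagonal_link x c pq qr rt tp quad.
  have c' : cyc q r t p by rewrite -cyc_rot.
  have lqt x := quad_diagonal_link x c' qr rt tp pq quad'.
  (* Neither the removed diagonal nor the added one can join [a] or [b] to their common neighbour,
     so the link is the same before and after the flip. *)
  split; last first.
    rewrite negbK; apply/eqP; apply: eq_pick => x /=;
      rewrite mem_polygon /= next_a.
    rewrite defV; apply/andP/andP=> -[ax bx].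
      have [l1 l2] := lpr x.
      by rewrite !inE ax bx (l1 ax) (l2 bx) !orbT.
    have [l1 l2] := lqt x.
    move: ax bx; rewrite !inE.
    move=> /orP[/eqP ax|/andP[_ ax]] /orP[/eqP bx|/andP[_ bx]] //.
    - have: [set a; x] = [set b; x] by rewrite ax.
      by case/set2_eq=> -[E1 E2]; move: nab; rewrite -?E2 E1 eqxx.
    - by have := l2 bx; rewrite ax eqxx.
    by have := l1 ax; rewrite bx eqxx.
  rewrite /flip triangulation_contraction //=.
  apply/existsP; exists (g p); apply/existsP; exists (g q).
  apply/existsP; exists (g r); apply/existsP; exists (g t).
  rewrite clockwise_polygon cyc_g //= !mem_edge_image ?inj // 1?eq_sym //=.
  have imU : edge_image g U = [set g p; g r] |: edge_image g W.
    by rewrite [in LHS]defU edge_imageU edge_image1 ?inj.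
  rewrite defV edge_imageU edge_image1 ?inj // imU setU1K //.
  (* No other edge of [U] has the image of the diagonal: since [g] identifies only [a] and [b], such
     an edge would join one of them to an end of the diagonal whose other end is the other one,
     which [lpr] forbids. *)
  apply/negP=> /edge_image_pair[x [y [xyW gx gy _]]].
  have /setD1P[xy_pr xyU] := xyW.
  case/g_inj: gx => [ex|[ex ep]|[ex ep]];
    case/g_inj: gy => [ey|[ey er]|[ey er]].
  - by rewrite ex ey eqxx in xy_pr.
  - by have [+ _] := lpr p; rewrite -{1}ex setUC -ey => /(_ xyU);
      rewrite setUC er eqxx.
  - by have [_ +] := lpr p; rewrite -{1}ex setUC -ey => /(_ xyU);
      rewrite setUC er eqxx.
  - by have [+ _] := lpr r; rewrite -{1}ey -ex => /(_ xyU); rewrite ep eqxx.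
  - by rewrite ep er eqxx in npr.
  - by move: quad; rewrite -ep -er mp mr.
  - by have [_ +] := lpr r; rewrite -{1}ey -ex => /(_ xyU); rewrite ep eqxx.
  - by move: quad; rewrite -ep -er mp mr.
  by rewrite ep er eqxx in npr.
move=> inab; left.
(* Once both diagonals have images already present in the image of [W], adding either of them to [W]
   leaves that image unchanged. *)
have eq_im : [set g q; g t] \in edge_image g W ->
    [set g p; g r] \in edge_image g W -> edge_image g V = edge_image g U.
  have absorb (e : {set 'I_n.+1}) x y : e = [set x; y] ->
      [set g x; g y] \in edge_image g W ->
      edge_image g (e |: W) = edge_image g W.
    move=> -> xy; have [u [v [_ _ _ gxy]]] := edge_image_pair xy.
    by rewrite edge_imageU edge_image1 // (setUidPr _) // sub1set.
  by move=> h1 h2; rewrite [in RHS]defU defV !(absorb _ _ _ erefl).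
have g_neq x y : x != y -> (x != a) || (y != b) -> (x != b) || (y != a) ->
  g x != g y.
  move=> xy h1 h2; apply/eqP=> /g_inj[exy|[xa yb]|[xb ya]].
  - by rewrite exy eqxx in xy.
  - by move: h1; rewrite xa yb !eqxx.
  by move: h2; rewrite xb ya !eqxx.
have g_W x y u v : g x = g u -> g y = g v -> [set u; v] \in W ->
    u != v -> (u != a) || (v != b) -> (u != b) || (v != a) ->
    [set g x; g y] \in edge_image g W.
  by move=> -> -> uvW uv h1 h2; apply: mem_edge_image => //; apply: g_neq.
have nqp : q != p by rewrite eq_sym.
have nrq : r != q by rewrite eq_sym.
have ntr : t != r by rewrite eq_sym.
have ntp : t != p by rewrite eq_sym.
have nrp : r != p by rewrite eq_sym.
have ntq : t != q by rewrite eq_sym.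
have neqs := (npq, npr, npt, nqr, nqt, nrt, nqp, nrq, ntr, ntp, nrp, ntq).
(* Only the four placements of [a] and [b] as clockwise consecutive corners remain. Each leaves two
   goals, one per diagonal, and the witness is the side that shares the image of that diagonal. *)
move: inab c; rewrite !inE => /andP[/or4P[]/eqP ea /or4P[]/eqP eb] c;
  try by [move: nab; rewrite ea eb eqxx
    | move: c; rewrite -ea -eb ?(cyc_ab, cyc_a_b) //
      cyc_rot ?(cyc_ab, cyc_a_b) // cyc_rot ?(cyc_ab, cyc_a_b) //
      cyc_rot ?(cyc_ab, cyc_a_b)];
  have E := g_ab; rewrite ea eb in E; apply: eq_im.
- by apply: (g_W _ _ p t); rewrite ?ea ?eb ?[[set p; t]]setUC ?E ?eqxx //=
    ?neqs ?orbT.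
- by apply: (g_W _ _ q r); rewrite ?ea ?eb ?E ?eqxx //= ?neqs ?orbT.
- by apply: (g_W _ _ r t); rewrite ?ea ?eb ?E ?eqxx //= ?neqs ?orbT.
- by apply: (g_W _ _ p q); rewrite ?ea ?eb ?E ?eqxx //= ?neqs ?orbT.
- by apply: (g_W _ _ q r); rewrite ?ea ?eb ?E ?eqxx //= ?neqs ?orbT.
- by apply: (g_W _ _ p t); rewrite ?ea ?eb ?[[set p; t]]setUC ?E ?eqxx //=
    ?neqs ?orbT.
- by apply: (g_W _ _ q p); rewrite ?ea ?eb ?[[set q; p]]setUC ?E ?eqxx //=
    ?neqs ?orbT.
by apply: (g_W _ _ t r); rewrite ?ea ?eb ?[[set t; r]]setUC ?E ?eqxx //=
  ?neqs ?orbT.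
Qed.

End Flip.

(** By [flip_contraction], a flip that stays a flip is never incident, so all incident flips are
    among those dropped from the path. *)
Lemma path_contraction U V (p : seq {set {set 'I_n.+1}}) :
  path (flip (polygon n.+1)) U p -> last U p = V ->
  exists p', [/\ path (flip (polygon n)) (edge_image g U) p',
    last (edge_image g U) p' = edge_image g V
  & size p' + count id (pairmap (incident (polygon n.+1) a) U p) <= size p].
Proof.
elim: p U => [|W p IHp] U /=; first by move=> _ ->; exists [::].
case/andP=> UW Wp lWp; have [p' [p1 p2 p3]] := IHp _ Wp lWp.
have triU : triangulation (polygon n.+1) U by case/andP: UW.
have [im|[fl /negbTE inc]] := flip_contraction triU UW.
  by exists p'; rewrite -im; split=> //; case: (incident _ _ _ _); lia.
by exists (edge_image g W :: p'); rewrite /= fl inc.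
Qed.

End Contraction.

(** * Vertex arithmetic modulo N *)

Ltac split_ifs :=
  repeat match goal with
  | |- context [if ?c then _ else _] =>
      lazymatch c with
      | context [if _ then _ else _] => fail
      | _ => case: (boolP c) => ?; try (exfalso; lia)
      end
  end.

(* The residue of [i] modulo [N], for [i < 2 * N] only. *)
Definition wrap_mod (N i : nat) : nat := if i < N then i else i - N.

Lemma modn_wrap_mod N i : i < N + N -> i %% N = wrap_mod N i.
Proof.
rewrite /wrap_mod => lti; case: ltnP => [/modn_small //|le].
by rewrite -{1}(subnK le) modnDr modn_small //; lia.
Qed.

Section OrdinalRing.

Variable n : nat.
Implicit Types x y : 'I_n.+4.

Lemma val_natr k : k < n.+4 -> (k%:R%R : 'I_n.+4) = k :> nat.
Proof. by move=> lt; rewrite Zp_nat /= modn_small. Qed.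

Lemma val_one : (1%R : 'I_n.+4) = 1 :> nat.
Proof. by rewrite /= modn_small. Qed.

Lemma val_addr x y : (x + y)%R = wrap_mod n.+4 (x + y) :> nat.
Proof.
by rewrite /= modn_wrap_mod //; have := ltn_ord x; have := ltn_ord y; lia.
Qed.

Lemma val_subr x y : (x - y)%R = wrap_mod n.+4 (x + (n.+4 - y)) :> nat.
Proof.
rewrite /= modnDmr modn_wrap_mod //.
by have := ltn_ord x; have := ltn_ord y; lia.
Qed.

Lemma val_natrD i j : i < n.+4 -> j < n.+4 ->
  (i%:R + j%:R : 'I_n.+4)%R = wrap_mod n.+4 (i + j) :> nat.
Proof. by move=> hi hj; rewrite val_addr !val_natr. Qed.

Lemma val_natrB i j : i < n.+4 -> j < n.+4 ->
  (i%:R - j%:R : 'I_n.+4)%R = wrap_mod n.+4 (i + (n.+4 - j)) :> nat.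
Proof. by move=> hi hj; rewrite val_subr !val_natr. Qed.

End OrdinalRing.

(** * Edges of the zigzag *)

(** The ends of an interior edge of odd index sum to 6 modulo N, those of even index to 5. Both ends
    being below N, the sum takes one of the four listed values. The remaining clauses are the
    boundary edges. *)
Definition zigzag_rel (N x y : nat) : bool :=
  (x != y) && [|| x + y == 5, x + y == 6, x + y == N + 5, x + y == N + 6,
    y == x.+1, x == y.+1, (x == 0) && (y == N.-1) | (y == 0) && (x == N.-1)].

Lemma zigzag_relC N x y : zigzag_rel N x y = zigzag_rel N y x.
Proof. by rewrite /zigzag_rel; lia. Qed.

Section Zigzag.

Variable k : nat.
Notation N := k.+4.+4.
Implicit Types x y : 'I_N.

Lemma zigzag_inv (e : {set 'I_N}) : e \in zigzag k.+4 ->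
  exists x y, e = [set x; y] /\ zigzag_rel N x y.
Proof.
rewrite inE => /orP[/imsetP[x _ ->]|/imsetP[i _ ->]].
  exists x, (next (polygon N) x); split=> //; have := ltn_ord x.
  by rewrite /zigzag_rel next_polygon; split_ifs; lia.
have lti := ltn_ord i; rewrite /zigzag_edge; do 2!eexists; split; first by [].
have lt_half : i.+1.-1./2 < N by lia.
case: ifP => oi; rewrite val_natrD // ?val_natrB // ?(val_natrB (i := 1)) //;
  by rewrite /zigzag_rel /wrap_mod; split_ifs; lia.
Qed.

Lemma mem_zigzag x y : ([set x; y] \in zigzag k.+4) = zigzag_rel N x y.
Proof.
apply/idP/idP=> [/zigzag_inv[u [v [/set2_eq[][-> ->]]]]|].
- by [].
- by rewrite zigzag_relC.
have mem_next (u v : 'I_N) : v = (if u.+1 < N then u.+1 else 0) :> nat ->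
    [set u; v] \in zigzag k.+4.
  move=> uv; have -> : v = next (polygon N) u.
    by apply: val_inj; rewrite /= next_polygon.
  by rewrite inE; apply/orP; left; apply/imsetP; exists u => //;
    apply: mem_polygon.
(* The index set of [zigzag] starts at 0, so the element 2j stands for the interior edge of index 2j
   + 1, with ends 2 - j and 4 + j. *)
have mem6 (u v : 'I_N) j : j.*2 < k.+4.+1 -> v = j + 4 :> nat ->
    u = wrap_mod N (N + 2 - j) :> nat -> [set u; v] \in zigzag k.+4.
  move=> lt hv hu; rewrite inE; apply/orP; right; apply/imsetP.
  exists (Ordinal lt); rewrite // /zigzag_edge /= odd_double /= doubleK.
  congr [set _; _]; apply: ord_inj;
    rewrite ?val_natrD ?val_natrB ?(val_natrB (i := 1)) //;
    try lia; rewrite ?hu ?hv /wrap_mod; split_ifs; lia.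
have mem5 (u v : 'I_N) j : j.*2.+1 < k.+4.+1 -> v = j + 4 :> nat ->
    u = wrap_mod N (N + 1 - j) :> nat -> [set u; v] \in zigzag k.+4.
  move=> lt hv hu; rewrite inE; apply/orP; right; apply/imsetP.
  exists (Ordinal lt); rewrite // /zigzag_edge /= odd_double /= uphalf_double.
  congr [set _; _]; apply: ord_inj;
    rewrite ?val_natrD ?val_natrB ?(val_natrB (i := 1)) //;
    try lia; rewrite ?hu ?hv /wrap_mod; split_ifs; lia.
wlog: x y / x < y => [hw|].
  case: (ltngtP x y) => [lt|lt|eq]; first exact: hw.
    by rewrite zigzag_relC setUC; apply: hw.
  by rewrite /zigzag_rel eq eqxx.
move=> ltxy zxy; have := ltn_ord x; have := ltn_ord y => ly lx.
have [yx|nyx] := eqVneq (y : nat) x.+1.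
  by apply: mem_next; rewrite yx; split_ifs; lia.
have [xy0|nxy0] := boolP ((x == 0 :> nat) && (y == N.-1 :> nat)).
  by rewrite setUC; apply: mem_next; split_ifs; lia.
have : [|| x + y == 5, x + y == 6, x + y == N + 5 | x + y == N + 6].
  by move: zxy; rewrite /zigzag_rel; lia.
case/or4P=> /eqP sxy.
(* The index comes from the end of the form 4 + j. It is the larger end [y] for the sums 5 and 6,
   and the smaller end [x] for the sums N + 5 and N + 6, where the other end has wrapped around. *)
- by apply: (mem5 _ _ (y - 4)); rewrite /wrap_mod; split_ifs; lia.
- by apply: (mem6 _ _ (y - 4)); rewrite /wrap_mod; split_ifs; lia.
- by rewrite setUC; apply: (mem5 _ _ (x - 4)); rewrite /wrap_mod; split_ifs;
    lia.
by rewrite setUC; apply: (mem6 _ _ (x - 4)); rewrite /wrap_mod; split_ifs; lia.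
Qed.

End Zigzag.

(** * Vertex deletion and relabeling *)

Definition redirect (T : eqType) (a b x : T) : T := if x == a then b else x.

Section NextRem.

Variable T : eqType.
Implicit Types (a x : T) (s : seq T).

Lemma next_at_redirect x y a z (q : seq T) : a \notin z :: q -> x \in z :: q ->
  next_at x y z q = redirect a y (next_at x a z q).
Proof.
elim: q z => [|z' q IHq] z; rewrite /= !inE ?negb_or.
  by move=> _ ->; rewrite /redirect eqxx.
case/and3P=> az az' aq; case: eqP => /= [_ _|_ xq].
  by rewrite /redirect eq_sym (negbTE az').
by apply: IHq; rewrite // inE negb_or az'.
Qed.

(** Only the predecessor of [a] gets a new successor, the old successor of [a]. The proof rotates
    [s] so that it begins with [a]. *)
Lemma next_rem s a x : uniq s -> x \in s -> x != a ->
  next (rem a s) x = redirect a (next s a) (next s x).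
Proof.
move=> us xs xa; have [as_|nas] := boolP (a \in s); last first.
  rewrite rem_id // /redirect; case: eqP => // na.
  by move: nas; rewrite -na mem_next xs.
case/splitPr: as_ us xs => s1 s2 us xs.
have -> : rem a (s1 ++ a :: s2) = s1 ++ s2.
  move: us; rewrite cat_uniq /= => /and3P[_ /norP[as1 _] _].
  elim: s1 as1 {xs} => [|z s1 IH] /=; first by rewrite eqxx.
  by rewrite inE negb_or eq_sym => /andP[/negbTE-> /IH->].
have us12 : uniq (s1 ++ s2).
  by move: us; rewrite !cat_uniq /= => /and3P[-> /norP[_ ->] /andP[_ ->]].
have us' : uniq (a :: s2 ++ s1) by rewrite -cat_cons uniq_catC.
have xs21 : x \in s2 ++ s1.
  by move: xs; rewrite !mem_cat inE (negbTE xa) orbC.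
have -> : next (s1 ++ s2) x = next (s2 ++ s1) x.
  by rewrite -(next_rot (size s1) us12) rot_size_cat.
have nx y : next (s1 ++ a :: s2) y = next (a :: s2 ++ s1) y.
  by rewrite -(next_rot (size s1) us) rot_size_cat.
rewrite !nx; case: (s2 ++ s1) us' xs21 => [//|z q] /= /andP[azq _] xzq.
by rewrite eqxx (negbTE xa); apply: next_at_redirect.
Qed.

Fixpoint redirects s (l : seq T) x : T :=
  if l is a :: l' then redirects (rem a s) l' (redirect a (next s a) x) else x.

(** Deletions move successors exactly as they move ends of edges, so one map, [redirects], describes
    both the remaining polygon and the resulting edge set. *)
Lemma next_foldl_rem s (l : seq T) x : uniq s -> x \in s -> x \notin l ->
  next (foldl (fun s a => rem a s) s l) x = redirects s l (next s x).
Proof.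
elim: l s => [//|a l IHl] s us xs; rewrite inE negb_or => /andP[xa xl] /=.
by rewrite IHl ?rem_uniq ?next_rem // mem_rem_uniq // inE xa.
Qed.

(** Deleting [a] sends it to [a1], and deleting [a1] sends both to [a2]; likewise for the second
    pair. As [a2] and [c2] lie outside both pairs, the two moves do not interfere. *)
Lemma redirects_two_pairs s a a1 a2 c c1 c2 x : uniq s ->
  [/\ next s a = a1, next s a1 = a2, next s c = c1 & next s c1 = c2] ->
  {subset [:: a; a1; c; c1] <= s} -> uniq [:: a; a1; c; c1] ->
  a2 \notin [:: a; a1; c; c1] -> c2 \notin [:: a; a1; c; c1] ->
  redirects s [:: a; a1; c; c1] x =
  if x \in [:: a; a1] then a2 else if x \in [:: c; c1] then c2 else x.
Proof.
move=> us [na na1 nc nc1] sub; rewrite /= !inE !negb_or.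
case/and4P=> /and3P[a_a1 a_c a_c1] /andP[a1_c a1_c1] c_c1 _.
case/and4P=> a2_a a2_a1 a2_c a2_c1 /and4P[c2_a c2_a1 c2_c c2_c1].
have [sa sa1 sc sc1] : [/\ a \in s, a1 \in s, c \in s & c1 \in s].
  by split; apply: sub; rewrite !inE eqxx ?orbT.
have [c1_a c1_a1] : (c1 == a) = false /\ (c1 == a1) = false.
  by rewrite ![c1 == _]eq_sym (negbTE a_c1) (negbTE a1_c1).
pose eqs := (c1_a, c1_a1, negbTE a_a1, negbTE a_c, negbTE a_c1, negbTE a1_c,
  negbTE a1_c1, negbTE c_c1, (negbTE a2_a, negbTE a2_a1, negbTE a2_c,
  negbTE a2_c1, negbTE c2_a, negbTE c2_a1, negbTE c2_c, negbTE c2_c1)).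
have us1 : uniq (rem a s) by rewrite rem_uniq.
have us2 : uniq (rem a1 (rem a s)) by rewrite rem_uniq.
have m1 z : z != a -> z \in s -> z \in rem a s.
  by move=> ? ?; rewrite mem_rem_uniq // inE; apply/andP.
have m2 z : z != a -> z != a1 -> z \in s -> z \in rem a1 (rem a s).
  by move=> ? ? ?; rewrite mem_rem_uniq // inE; apply/andP; split;
    last exact: m1.
have E1 : next (rem a s) a1 = a2.
  by rewrite next_rem // 1?eq_sym // na1 /redirect eqs.
have E2 : next (rem a1 (rem a s)) c = c1.
  rewrite next_rem ?m1 // 1?eq_sym // E1 next_rem // 1?eq_sym // nc /redirect.
  by rewrite !eqs.
have E3 : next (rem c (rem a1 (rem a s))) c1 = c2.
  rewrite next_rem ?m2 // 1?eq_sym // E2 next_rem ?m1 // 1?eq_sym // E1.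
  by rewrite next_rem // 1?eq_sym // nc1 na /redirect !eqs.
rewrite na E1 E2 E3 /redirect.
have [->|xa] := eqVneq x a; first by rewrite eqxx !eqs.
have [->|xa1] := eqVneq x a1; first by rewrite !eqs.
have [->|xc] := eqVneq x c; first by rewrite eqxx !eqs.
by have [->|xc1] := eqVneq x c1; rewrite ?eqs.
Qed.

End NextRem.

(** Among two-element sets, [redirect] collapses only the edge from [a] to its successor, which is
    exactly the one that [deletion] discards. *)
Lemma deletionE (T : finType) (s : seq T) (U : {set {set T}}) a :
  (forall e, e \in U -> #|e| = 2) ->
  deletion s U a = edge_image (redirect a (next s a)) U.
Proof.
move=> U2; have im x y : [set redirect a (next s a) z | z in [set x; y]] =
    [set redirect a (next s a) x; redirect a (next s a) y].
  by rewrite imsetU1 imset_set1.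
apply/setP=> e; apply/imsetP/edge_imageP.
  case=> f /setD1P[fab fU] ->; have /eqP/cards2P[x [y [xy fE]]] := U2 f fU.
  subst f; exists x, y; split=> //; rewrite ?im //.
  apply: contra fab; rewrite /redirect.
  have [xa|xa] := eqVneq x a; have [ya|ya] := eqVneq y a.
  - by move: xy; rewrite xa ya eqxx.
  - by rewrite xa => /eqP->.
  - by rewrite ya => /eqP->; rewrite setUC.
  by rewrite (negbTE xy).
case=> x [y [xyU mxy ->]]; exists [set x; y]; rewrite ?im //.
apply/setD1P; split=> //; apply: contra mxy => /eqP/set2_eq[][-> ->];
  by rewrite /redirect; case: (eqVneq (next s a) a); rewrite ?eqxx.
Qed.

Lemma edge_image_card (T T' : finType) (g : T -> T') U e :
  e \in edge_image g U -> #|e| = 2.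
Proof. by case/edge_imageP=> x [y [_ gxy ->]]; rewrite cards2 gxy. Qed.

Lemma foldl_delete_vertex (T : finType) (s : seq T) (U : {set {set T}}) a l :
  (forall e, e \in U -> #|e| = 2) ->
  foldl (@delete_vertex T) (s, U) (a :: l) =
  (foldl (fun s a => rem a s) s (a :: l), edge_image (redirects s (a :: l)) U).
Proof.
elim: l s a U => [|b l IHl] s a U U2.
  by rewrite /= /delete_vertex /= deletionE.
rewrite -[LHS]/(foldl (@delete_vertex T) (delete_vertex (s, U) a) (b :: l)).
rewrite /delete_vertex /=.
rewrite -[LHS]/(foldl (@delete_vertex T) (rem a s, deletion s U a) (b :: l)).
rewrite deletionE // IHl; last by move=> e; apply: edge_image_card.
by rewrite edge_image_comp.
Qed.

(** [relabel] is a preimage under the walk that sends a label to its vertex. Injectivity of the walk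
    turns it into an image under any labeling [g] compatible with the walk. *)
Lemma relabel_edge_image n (T T' : finType) (s : seq T) (E : {set {set T'}}) v l
    (M : T' -> T) (g : T' -> 'I_n) :
  injective (fun j : 'I_n => iter (n + j - l) (next s) v) ->
  (forall x, iter (n + g x - l) (next s) v = M x) ->
  relabel n (s, edge_image M E) v l = edge_image g E.
Proof.
set f := (fun j : 'I_n => _) => inj_f fg; apply/setP=> e; rewrite inE /=.
have im x y : [set f j | j in [set g x; g y]] = [set M x; M y].
  by rewrite imsetU1 imset_set1 /f !fg.
have neq x y : (M x != M y) = (g x != g y) by rewrite -!fg (inj_eq inj_f).
apply/edge_imageP/edge_imageP=> -[x [y [xyE mxy ee]]]; exists x, y; split=> //.
- by rewrite -neq.
- by apply: (imset_inj inj_f); rewrite im -ee.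
- by rewrite neq.
by rewrite ee -im.
Qed.

(** Here [F] enumerates clockwise, from [v] on, the n vertices left by the deletions. The range up
    to 2n covers the n + j - l steps used by [relabel]. *)
Lemma val_iter_cyclic N n (f : 'I_N -> 'I_N) (v : 'I_N) (F : nat -> nat) :
  v = F 0 :> nat ->
  (forall i (x : 'I_N), i < n -> x = F i :> nat ->
    f x = F (if i.+1 < n then i.+1 else 0) :> nat) ->
  forall i, i < n + n -> iter i f v = F (wrap_mod n i) :> nat.
Proof.
move=> v0 step; elim=> [|i IHi] lti; first by rewrite /wrap_mod; split_ifs.
rewrite iterS (step (wrap_mod n i)); last by apply: IHi; lia.
  by congr F; rewrite /wrap_mod; split_ifs; lia.
by rewrite /wrap_mod; split_ifs; lia.
Qed.

(* [label_minus n x] is the vertex of A_n^- to which the deletions and the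
   relabeling send the vertex [x] of Z_{n+4}; [h] is bar 0.  For A_n^+, the
   representatives [r] in 2, ..., n + 5 make the labels increase with [r]. *)
Definition label_minus (n x : nat) : nat :=
  let h := (n.+4)./2 in
  wrap_mod n (if x < 2 then 2 else if x < h then x
              else if x <= h.+2 then h else x - 2).

Definition label_plus (n x : nat) : nat :=
  let h := (n.+4)./2 in
  let r := if x < 2 then x + n.+4 else x in
  wrap_mod n (if r <= 3 then r - 1 else if r <= 6 then 3
              else if r <= h + 3 then r - 3
              else if r <= h + 6 then h.+1 else r - 5).

(** * The pair [A] as images of a zigzag *)

Section APairs.

Variable k : nat.
Notation n := k.+4.
Notation N := k.+4.+4.

Lemma zigzag_card e : e \in zigzag n -> #|e| = 2.
Proof.
case/zigzag_inv=> x [y [-> /andP[]]].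
by rewrite cards2 val_eqE => ->.
Qed.

Lemma val_redirects_two_pairs (a a1 a2 c c1 c2 : 'I_N) (x : 'I_N) :
  a1 = wrap_mod N a.+1 :> nat -> a2 = wrap_mod N a1.+1 :> nat ->
  c1 = wrap_mod N c.+1 :> nat -> c2 = wrap_mod N c1.+1 :> nat ->
  uniq [:: nat_of_ord a; nat_of_ord a1; nat_of_ord c; nat_of_ord c1] ->
  nat_of_ord a2 \notin
    [:: nat_of_ord a; nat_of_ord a1; nat_of_ord c; nat_of_ord c1] ->
  nat_of_ord c2 \notin
    [:: nat_of_ord a; nat_of_ord a1; nat_of_ord c; nat_of_ord c1] ->
  redirects (polygon N) [:: a; a1; c; c1] x =
  (if (x == a :> nat) || (x == a1 :> nat) then nat_of_ord a2
   else if (x == c :> nat) || (x == c1 :> nat) then nat_of_ord c2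
   else x) :> nat.
Proof.
move=> h1 h2 h3 h4 u n1 n2.
have nextE (y z : 'I_N) : z = wrap_mod N y.+1 :> nat -> next (polygon N) y = z.
  move=> yz; apply: ord_inj; rewrite next_polygon yz /wrap_mod.
  by have := ltn_ord y; split_ifs; lia.
have mapE (z : 'I_N) s :
    (nat_of_ord z \in [seq nat_of_ord i | i <- s]) = (z \in s).
  by rewrite (mem_map (@ord_inj N)).
have lE : [:: nat_of_ord a; nat_of_ord a1; nat_of_ord c; nat_of_ord c1] =
          [seq nat_of_ord i | i <- [:: a; a1; c; c1]] by [].
rewrite lE mapE in n1; rewrite lE mapE in n2.
rewrite lE (map_inj_uniq (@ord_inj N)) in u.
rewrite (@redirects_two_pairs _ _ a a1 a2 c c1 c2) ?polygon_uniq //.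
- by rewrite !inE -!val_eqE; split_ifs.
- by split; apply: nextE.
by move=> z _; apply: mem_polygon.
Qed.

Lemma A_minusE : A_minus n =
  edge_image (fun x : 'I_N => inord (label_minus n x) : 'I_n) (zigzag n).
Proof.
rewrite /A_minus foldl_delete_vertex; last exact: zigzag_card.
pose h := N./2; have [h1 h2] : h.*2 <= N /\ N <= h.*2.+1 by rewrite /h; lia.
have b0 : bar (0%R : 'I_N) = h :> nat.
  by rewrite /bar (val_natrD (i := 0)) /wrap_mod -/h; split_ifs; lia.
have b1 : bar (1%R : 'I_N) = h.+1 :> nat.
  by rewrite /bar (val_natrD (i := 1)) /wrap_mod -/h; split_ifs; lia.
have ME (x : 'I_N) : redirects (polygon N) [:: 0; 1; bar 0; bar 1]%R x =
    (if x < 2 then 2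
     else if (x == h :> nat) || (x == h.+1 :> nat) then h.+2 else x) :> nat.
  have b2 : (inord h.+2 : 'I_N) = h.+2 :> nat by rewrite inordK //; lia.
  rewrite (@val_redirects_two_pairs _ _ (2%:R)%R _ _ (inord h.+2));
    rewrite ?b0 ?b1 ?b2 ?val_one ?val_natr //;
    rewrite /= ?inE; try by [rewrite /wrap_mod; split_ifs; lia | lia].
set l := [:: _; _; _; _] in ME *; set s4 := foldl _ _ _.
have nextE (x : 'I_N) : 2 <= x -> x != h :> nat -> x != h.+1 :> nat ->
    next s4 x = (let y := wrap_mod N x.+1 in if y < 2 then 2
                 else if (y == h) || (y == h.+1) then h.+2 else y) :> nat.
  move=> x2 xh xh1; rewrite next_foldl_rem ?polygon_uniq ?mem_polygon //.
    rewrite ME next_polygon /wrap_mod; have := ltn_ord x; split_ifs; lia.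
  by rewrite /l !inE -!(inj_eq (@ord_inj N)) b0 b1 val_one /=; lia.
(* The survivors, clockwise from 2, are 2, ..., h - 1 and then h + 2, ..., N - 1. *)
have iterE := @val_iter_cyclic N n (next s4) 2%:R%R
  (fun i => if i < h - 2 then i + 2 else i + 4) _ _.
have {}iterE i : i < n + n -> iter i (next s4) 2%:R%R =
    (let j := wrap_mod n i in if j < h - 2 then j + 2 else j + 4) :> nat.
  apply: iterE => [|j x ltj xj]; first by rewrite val_natr //; split_ifs; lia.
  by rewrite nextE xj /wrap_mod; split_ifs; lia.
apply: relabel_edge_image => [i j ij|x].
  have [lti ltj] := conj (ltn_ord i) (ltn_ord j).
  apply: ord_inj; move: (congr1 (@nat_of_ord N) ij).
  by rewrite !iterE /= /wrap_mod; split_ifs; lia.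
have ltx := ltn_ord x; have lt_label : label_minus n x < n.
  by rewrite /label_minus -/h /wrap_mod; split_ifs; lia.
apply: ord_inj; rewrite ME inordK // iterE /= /label_minus -/h /wrap_mod;
  last by split_ifs; lia.
by split_ifs; lia.
Qed.

Lemma A_plusE : A_plus n =
  edge_image (fun x : 'I_N => inord (label_plus n x) : 'I_n) (zigzag n).
Proof.
rewrite /A_plus foldl_delete_vertex; last exact: zigzag_card.
pose h := N./2; have [h1 h2] : h.*2 <= N /\ N <= h.*2.+1 by rewrite /h; lia.
(* The sums h + 4 and h + 5 may reach N: for N = 8 these vertices are 0 and 1. *)
have b4 : bar (4%:R%R : 'I_N) = wrap_mod N (h + 4) :> nat.
  by rewrite /bar val_natrD -/h ?[h + 4]addnC //; lia.
have b5 : bar (5%:R%R : 'I_N) = wrap_mod N (h + 5) :> nat.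
  by rewrite /bar val_natrD -/h ?[h + 5]addnC //; lia.
pose M (y : nat) := if (y == 4) || (y == 5) then 6
  else if (y == wrap_mod N (h + 4)) || (y == wrap_mod N (h + 5))
  then wrap_mod N (h + 6) else y.
have ME (x : 'I_N) :
    redirects (polygon N) [:: 4%:R; 5%:R; bar 4%:R; bar 5%:R]%R x = M x :> nat.
  have b6 : (inord (wrap_mod N (h + 6)) : 'I_N) = wrap_mod N (h + 6) :> nat.
    by rewrite inordK // /wrap_mod; split_ifs; lia.
  pose b := inord (wrap_mod N (h + 6)) : 'I_N.
  rewrite (@val_redirects_two_pairs _ _ (6%:R)%R _ _ b);
    rewrite ?b4 ?b5 /b ?b6 ?val_natr //= ?inE;
    by rewrite /wrap_mod; split_ifs; lia.
set l := [:: _; _; _; _] in ME *; set s4 := foldl _ _ _.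
have nextE (x : 'I_N) : x != 4 :> nat -> x != 5 :> nat ->
    x != wrap_mod N (h + 4) :> nat -> x != wrap_mod N (h + 5) :> nat ->
    next s4 x = M (wrap_mod N x.+1) :> nat.
  move=> x4 x5 xh4 xh5; rewrite next_foldl_rem ?polygon_uniq ?mem_polygon //.
    rewrite ME next_polygon; congr M; rewrite /wrap_mod; have := ltn_ord x.
    by split_ifs; lia.
  by rewrite /l !inE -!(inj_eq (@ord_inj N)) b4 b5 !val_natr //; lia.
(* The survivors, clockwise from 2, are 2, 3, then 6, ..., h + 3, then the vertices from h + 6 on,
   modulo N, up to 1. *)
have iterE := @val_iter_cyclic N n (next s4) 2%:R%R
  (fun i => if i < 2 then i + 2 else if i < h then i + 4
            else wrap_mod N (i + 6)) _ _.
have {}iterE i : i < n + n -> iter i (next s4) 2%:R%R =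
    (let j := wrap_mod n i in
     if j < 2 then j + 2 else if j < h then j + 4
     else wrap_mod N (j + 6)) :> nat.
  apply: iterE => [|j x ltj xj]; first by rewrite val_natr.
  by rewrite nextE xj /M /wrap_mod; split_ifs; lia.
apply: relabel_edge_image => [i j ij|x].
  have [lti ltj] := conj (ltn_ord i) (ltn_ord j).
  apply: ord_inj; move: (congr1 (@nat_of_ord N) ij).
  by rewrite !iterE /= /wrap_mod; split_ifs; lia.
have ltx := ltn_ord x; have lt_label : label_plus n x < n.
  by rewrite /label_plus -/h /wrap_mod; split_ifs; lia.
apply: ord_inj; rewrite ME inordK // iterE /= /M /label_plus -/h /wrap_mod;
  last by split_ifs; lia.
by split_ifs; lia.
Qed.

End APairs.

(** * Geodesics and incident flips *)

Lemma delta_leq_path (T : finType) (s : seq T) U V p :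
  path (flip s) U p -> last U p = V -> delta s (U, V) <= size p.
Proof.
move=> Up lUp; rewrite /delta; destruct idP as [c|c]; last by [].
case: ex_minnP => m _; apply; apply/existsP; exists (in_tuple p).
by rewrite /flip_path Up lUp eqxx.
Qed.

(** A maximum over an empty family is 0, so a positive [m] ensures that some geodesic attains the
    bound. *)
Lemma theta_path (T : finType) (s : seq T) U V a m :
  0 < m -> m <= theta s (U, V) a ->
  exists p, [/\ path (flip s) U p, last U p = V, size p = delta s (U, V)
    & m <= count id (pairmap (incident s a) U p)].
Proof.
move=> m_gt0 le_m.
have [/existsP[p /andP[/andP[Up /eqP lp] cp]]|] := boolP
  [exists p : (delta s (U, V)).-tuple _, flip_path s U V p &&
     (m <= count id (pairmap (incident s a) U p))].
  by exists p; rewrite size_tuple.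
rewrite negb_exists => /forallP no; suff: theta s (U, V) a <= m.-1 by lia.
by apply/bigmax_leqP=> p Up; have := no p; rewrite Up /=; lia.
Qed.

(** Without incident flips the link would be constant along the path. *)
Lemma count_incident_gt0 (T : finType) (s : seq T) a U V p :
  last U p = V -> lk s a U != lk s a V ->
  0 < count id (pairmap (incident s a) U p).
Proof.
elim: p U => [|W p IHp] U /=; first by move=> ->; rewrite eqxx.
move=> lp; rewrite /incident; have [->|_] := eqVneq (lk s a U) (lk s a W);
  last by [].
by move=> h; apply: IHp.
Qed.

(** * The two contractions applied to [A] *)

Section Reduction.

Variable k : nat.

Definition contract3 (x : 'I_k.+4.+2) : 'I_k.+4.+1 :=
  inord (if x <= 3 then x : nat else x.-1).

(** Besides contracting the edge from 1 to 2, this turns all labels by one step clockwise, so that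
    the outcome carries the labels of the smaller pair. *)
Definition contract1 (x : 'I_k.+4.+1) : 'I_k.+4 :=
  inord (if x <= 1 then x.+1 else if x == k.+4 :> nat then 0 else x).

Lemma val_contract3 x : contract3 x = (if x <= 3 then x : nat else x.-1) :> nat.
Proof.
by have ltx := ltn_ord x; rewrite /contract3 inordK //; split_ifs; lia.
Qed.

Lemma val_contract1 x : contract1 x =
  (if x <= 1 then x.+1 else if x == k.+4 :> nat then 0 else x) :> nat.
Proof.
by have ltx := ltn_ord x; rewrite /contract1 inordK //; split_ifs; lia.
Qed.

Lemma contract3_path (v3 : 'I_k.+4.+2) U V p : v3 = 3 :> nat ->
  path (flip (polygon k.+4.+2)) U p -> last U p = V ->
  exists p', [/\ path (flip (polygon k.+4.+1)) (edge_image contract3 U) p',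
    last (edge_image contract3 U) p' = edge_image contract3 V
  & size p' + count id (pairmap (incident (polygon k.+4.+2) v3) U p) <= size p].
Proof.
move=> v3E; pose v4 : 'I_k.+4.+2 := inord 4.
have v4E : v4 = 4 :> nat by rewrite inordK.
apply: (path_contraction (b := v4)).
- by [].
- by apply: ord_inj; rewrite next_polygon v3E v4E.
- by apply: ord_inj; rewrite !val_contract3 v3E v4E.
- move=> x y /(congr1 (@nat_of_ord _)); rewrite !val_contract3.
  case: (ltngtP x y) => [||/ord_inj-> _]; last by constructor 1.
    move=> lt h; constructor 2; split; apply: ord_inj; move: h;
      rewrite ?v3E ?v4E; split_ifs; lia.
  move=> lt h; constructor 3; split; apply: ord_inj; move: h;
    rewrite ?v3E ?v4E; split_ifs; lia.
- move=> z; exists (inord (if z <= 3 then z : nat else z.+1)).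
  have := ltn_ord z => ltz.
  by apply: ord_inj; rewrite val_contract3 inordK; split_ifs; lia.
- by move=> x y z t; rewrite !val_contract3 /cyc; split_ifs; lia.
move=> x y z t c; rewrite !inE -!(inj_eq (@ord_inj _)) v3E v4E !val_contract3.
by move: c; rewrite /cyc; split_ifs; lia.
Qed.

Lemma contract1_path (v1 : 'I_k.+4.+1) U V p : v1 = 1 :> nat ->
  path (flip (polygon k.+4.+1)) U p -> last U p = V ->
  exists p', [/\ path (flip (polygon k.+4)) (edge_image contract1 U) p',
    last (edge_image contract1 U) p' = edge_image contract1 V
  & size p' + count id (pairmap (incident (polygon k.+4.+1) v1) U p) <= size p].
Proof.
move=> v1E; pose v2 : 'I_k.+4.+1 := inord 2.
have v2E : v2 = 2 :> nat by rewrite inordK.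
apply: (path_contraction (b := v2)).
- by [].
- by apply: ord_inj; rewrite next_polygon v1E v2E.
- by apply: ord_inj; rewrite !val_contract1 v1E v2E.
- move=> x y /(congr1 (@nat_of_ord _)); rewrite !val_contract1.
  have := ltn_ord x; have := ltn_ord y => ly lx.
  case: (ltngtP x y) => [||/ord_inj-> _]; last by constructor 1.
    move=> lt h; constructor 2; split; apply: ord_inj; move: h;
      rewrite ?v1E ?v2E; split_ifs; lia.
  move=> lt h; constructor 3; split; apply: ord_inj; move: h;
    rewrite ?v1E ?v2E; split_ifs; lia.
- move=> z; exists (inord
    (if z == 0 :> nat then k.+4 else if z == 1 :> nat then 0 else z)).
  have := ltn_ord z => ltz.
  by apply: ord_inj; rewrite val_contract1 inordK; split_ifs; lia.
- move=> x y z t; rewrite !val_contract1 /cyc.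
  have := ltn_ord x; have := ltn_ord y; have := ltn_ord z; have := ltn_ord t.
  by split_ifs; lia.
move=> x y z t c; rewrite !inE -!(inj_eq (@ord_inj _)) v1E v2E !val_contract1.
have := ltn_ord x; have := ltn_ord y; have := ltn_ord z; have := ltn_ord t.
by move: c; rewrite /cyc; split_ifs; lia.
Qed.

End Reduction.

(** * Identification of the contracted pair *)

Section PairReduction.

Variable k : nat.
Notation N := k.+4.+4.

(* Contractions of Z_{n+2} onto Z_n, of the edges {1, 2} and {3, 4} for
   [shift_minus] and {2, 3} and {4, 5} for [shift_plus].  They are chosen so
   that the contractions of {3, 4} and {1, 2} in A_n become the labelings of
   A_{n-2} precomposed with them. *)
Definition shift_minus (x : nat) : nat :=
  if x == 0 then 1 else if x == 1 then 2 else if x <= 3 then x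
  else wrap_mod N x.-1.

Definition shift_plus (x : nat) : nat :=
  if x == 0 then 1 else if x == 1 then 2 else if x <= 3 then 3
  else if x == 4 then 4 else wrap_mod N x.-1.

Lemma edge_image_zigzag (f : nat -> nat) :
  (forall i, i < N.+2 -> f i < N) ->
  (forall i j, i < N.+2 -> j < N.+2 -> zigzag_rel N.+2 i j -> f i != f j ->
     zigzag_rel N (f i) (f j)) ->
  (forall i j, i < N -> j < N -> zigzag_rel N i j ->
     exists i' j', [/\ i' < N.+2, j' < N.+2, zigzag_rel N.+2 i' j',
       f i' = i & f j' = j]) ->
  edge_image (fun x : 'I_N.+2 => inord (f x) : 'I_N) (zigzag k.+4.+2) =
  zigzag k.+4.
Proof.
move=> ltf f_rel f_surj.
have fE (x : 'I_N.+2) : (inord (f x) : 'I_N) = f x :> nat.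
  by rewrite inordK ?ltf.
apply/setP=> e; apply/edge_imageP/idP=> [[x [y [xyZ fxy ->]]]|].
  rewrite mem_zigzag in xyZ; rewrite mem_zigzag !fE.
  apply: (f_rel _ _ (ltn_ord x) (ltn_ord y) xyZ).
  by apply: contraNneq fxy => ->.
case/zigzag_inv=> x [y [-> xy]].
have [i [j [lti ltj ij fi fj]]] := f_surj x y (ltn_ord x) (ltn_ord y) xy.
exists (Ordinal lti), (Ordinal ltj).
have -> : inord (f (Ordinal lti)) = x by apply: ord_inj; rewrite fE.
have -> : inord (f (Ordinal ltj)) = y by apply: ord_inj; rewrite fE.
split=> //; first by rewrite mem_zigzag.
by case/andP: xy; rewrite (inj_eq (@ord_inj N)).
Qed.

Lemma edge_image_shift_minus :
  edge_image (fun x : 'I_N.+2 => inord (shift_minus x) : 'I_N)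
    (zigzag k.+4.+2) = zigzag k.+4.
Proof.
apply: edge_image_zigzag.
- by move=> i lti; rewrite /shift_minus /wrap_mod; split_ifs; lia.
- by move=> i j lti ltj; rewrite /shift_minus /wrap_mod /zigzag_rel; split_ifs;
    lia.
move=> i j lti ltj zij.
(* [t] is a section of [shift_minus]: it lowers 0, 1, 2 by one modulo N + 2 and raises the rest.
   Sums 5 and 6 have one end of each kind and are kept modulo N + 2; sums N + 5 and N + 6 have both
   ends raised and become N + 7 and N + 8. *)
pose t x := if x == 0 then N.+1 else if x == 1 then 0 else if x == 2 then 1
  else x.+1.
have [ij|nij] := boolP ((i == 2) && (j == 3) || (i == 3) && (j == 2)).
  by exists i, j; move: zij ij; rewrite /shift_minus /zigzag_rel => ? ?; split;
    split_ifs; lia.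
exists (t i), (t j); move: zij; rewrite /zigzag_rel => zij.
by rewrite /t /shift_minus /wrap_mod; split; split_ifs; lia.
Qed.

Lemma edge_image_shift_plus :
  edge_image (fun x : 'I_N.+2 => inord (shift_plus x) : 'I_N)
    (zigzag k.+4.+2) = zigzag k.+4.
Proof.
apply: edge_image_zigzag.
- by move=> i lti; rewrite /shift_plus /wrap_mod; split_ifs; lia.
- by move=> i j lti ltj; rewrite /shift_plus /wrap_mod /zigzag_rel; split_ifs;
    lia.
move=> i j lti ltj zij.
pose t x := if x == 0 then N.+1 else if x == 1 then 0 else if x == 2 then 1
  else if x == 3 then 2 else x.+1.
(* The section sends 3 and 4 to 2 and 5, whose sum 7 is not that of a zigzag edge; this edge is
   lifted to itself instead. *)
have [ij|nij] := boolP ((i == 3) && (j == 4) || (i == 4) && (j == 3)).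
  by exists i, j; move: zij ij; rewrite /shift_plus /zigzag_rel => ? ?; split;
    split_ifs; lia.
exists (t i), (t j); move: zij; rewrite /zigzag_rel => zij.
by rewrite /t /shift_plus /wrap_mod; split; split_ifs; lia.
Qed.

(** Writing the smaller zigzag as an image of the larger one makes both sides images of the same
    zigzag, under vertex maps that agree at every vertex. *)
Lemma contract_A_minus :
  edge_image (@contract1 k) (edge_image (@contract3 k) (A_minus k.+4.+2)) =
  A_minus k.+4.
Proof.
rewrite (A_minusE k.+2) A_minusE -edge_image_shift_minus !edge_image_comp.
apply: eq_edge_image => x /=; apply: ord_inj; have ltx := ltn_ord x.
pose h := N./2; have [h1 h2] : h.*2 <= N /\ N <= h.*2.+1 by rewrite /h; lia.
have hE : (k.+4.+2.+4)./2 = h.+1 by rewrite /h; lia.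
have l1 : label_minus k.+4.+2 x < k.+4.+2.
  by rewrite /label_minus hE /wrap_mod; split_ifs; lia.
have l2 : shift_minus x < N by rewrite /shift_minus /wrap_mod; split_ifs; lia.
have l3 : label_minus k.+4 (shift_minus x) < k.+4.
  by rewrite /label_minus -/h; move: l2; case: (shift_minus x) => [|i] li;
    rewrite /wrap_mod; split_ifs; lia.
rewrite val_contract1 val_contract3 inordK // inordK // inordK //.
by rewrite /label_minus hE -/h /shift_minus /wrap_mod; split_ifs; lia.
Qed.

Lemma contract_A_plus :
  edge_image (@contract1 k) (edge_image (@contract3 k) (A_plus k.+4.+2)) =
  A_plus k.+4.
Proof.
rewrite (A_plusE k.+2) A_plusE -edge_image_shift_plus !edge_image_comp.
apply: eq_edge_image => x /=; apply: ord_inj; have ltx := ltn_ord x.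
pose h := N./2; have [h1 h2] : h.*2 <= N /\ N <= h.*2.+1 by rewrite /h; lia.
have hE : (k.+4.+2.+4)./2 = h.+1 by rewrite /h; lia.
have l1 : label_plus k.+4.+2 x < k.+4.+2.
  by rewrite /label_plus hE /wrap_mod; split_ifs; lia.
have l2 : shift_plus x < N by rewrite /shift_plus /wrap_mod; split_ifs; lia.
have l3 : label_plus k.+4 (shift_plus x) < k.+4.
  by rewrite /label_plus -/h; move: l2; case: (shift_plus x) => [|i] li;
    rewrite /wrap_mod; split_ifs; lia.
rewrite val_contract1 val_contract3 inordK // inordK // inordK //.
by rewrite /label_plus hE -/h /shift_plus /wrap_mod; split_ifs; lia.
Qed.

(** In the contracted [A_plus] the vertices 1, 2, 3 span a triangle and the link is 3, while the
    contracted [A_minus] has no edge between 1 and 3. *)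
Lemma lk_contract3 (v1 : 'I_k.+4.+1) : v1 = 1 :> nat ->
  lk (polygon k.+4.+1) v1 (edge_image (@contract3 k) (A_minus k.+4.+2)) !=
  lk (polygon k.+4.+1) v1 (edge_image (@contract3 k) (A_plus k.+4.+2)).
Proof.
move=> v1E.
pose h := N./2; have [h1 h2] : h.*2 <= N /\ N <= h.*2.+1 by rewrite /h; lia.
have hE : (k.+4.+2.+4)./2 = h.+1 by rewrite /h; lia.
have v2E : next (polygon k.+4.+1) v1 = 2 :> nat by rewrite next_polygon v1E.
have lab_m (x : 'I_N.+2) :
    (inord (label_minus k.+4.+2 x) : 'I_k.+4.+2) = label_minus k.+4.+2 x :> nat.
  by have ltx := ltn_ord x; rewrite inordK // /label_minus hE /wrap_mod;
    split_ifs; lia.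
have lab_p (x : 'I_N.+2) :
    (inord (label_plus k.+4.+2 x) : 'I_k.+4.+2) = label_plus k.+4.+2 x :> nat.
  by have ltx := ltn_ord x; rewrite inordK // /label_plus hE /wrap_mod;
    split_ifs; lia.
rewrite (A_minusE k.+2) (A_plusE k.+2) !edge_image_comp /lk.
set v2 := next _ _ in v2E *.
pose v3 : 'I_k.+4.+1 := inord 3; have v3E : v3 = 3 :> nat by rewrite inordK.
set Em := edge_image _ _; set Ep := edge_image _ _.
have Em13 : [set v1; v3] \notin Em.
  apply/negP=> /edge_image_pair[x [y [+ xv yv _]]]; rewrite (@mem_zigzag k.+2).
  move: (congr1 (@nat_of_ord _) xv) (congr1 (@nat_of_ord _) yv) => /=.
  rewrite !val_contract3 !lab_m v1E v3E.
  have ltx := ltn_ord x; have lty := ltn_ord y.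
  (* Label 1 comes only from the vertex N + 1 and, after contraction, label 3 only from the vertices
     3 and 4; the zigzag joins N + 1 to neither. *)
  move=> hx hy; have xE : x = N.+1 :> nat.
    by move: hx; rewrite /label_minus hE /wrap_mod; split_ifs; lia.
  have yE : (y == 3 :> nat) || (y == 4 :> nat).
    by move: hy; rewrite /label_minus hE /wrap_mod; split_ifs; lia.
  by rewrite /zigzag_rel xE; lia.
have Ep2 z : [set v2; z] \in Ep -> z = v1 \/ z = v3.
  case/edge_image_pair=> x [y [+ xv yv _]]; rewrite (@mem_zigzag k.+2).
  move: (congr1 (@nat_of_ord _) xv) (congr1 (@nat_of_ord _) yv) => /=.
  rewrite !val_contract3 !lab_p v2E.
  have ltx := ltn_ord x; have lty := ltn_ord y.
  (* Label 2 comes only from the vertex 3, whose zigzag neighbours are just 2 and 4, labeled 1 and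
     3. *)
  move=> hx hy; have xE : x = 3 :> nat.
    by move: hx; rewrite /label_plus hE /wrap_mod; split_ifs; lia.
  rewrite /zigzag_rel xE => xy.
  have : (y == 2 :> nat) || (y == 4 :> nat) by lia.
  case/orP=> /eqP yE; move: hy; rewrite /label_plus hE yE /wrap_mod => hy.
    by left; apply: ord_inj; rewrite v1E -hy; split_ifs; lia.
  by right; apply: ord_inj; rewrite v3E -hy; split_ifs; lia.
have memEp (u v : 'I_k.+4.+1) i j : i < N.+2 -> j < N.+2 ->
    zigzag_rel N.+2 i j -> label_plus k.+4.+2 i = u ->
    label_plus k.+4.+2 j = v -> u != v -> u <= 3 -> v <= 3 ->
    [set u; v] \in Ep.
  move=> lti ltj ij iu jv uv u3 v3'; apply/edge_imageP.
  exists (Ordinal lti), (Ordinal ltj); rewrite (@mem_zigzag k.+2).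
  pose f (x : 'I_N.+2) := @contract3 k (inord (label_plus k.+4.+2 x)).
  have fu : f (Ordinal lti) = u.
    by apply: ord_inj; rewrite val_contract3 (lab_p (Ordinal lti)) /= iu u3.
  have fv : f (Ordinal ltj) = v.
    by apply: ord_inj; rewrite val_contract3 (lab_p (Ordinal ltj)) /= jv v3'.
  split; [exact: ij | | by rewrite -fu -fv].
  by rewrite -[X in X != _]/(f _) -[X in _ != X]/(f _) fu fv.
(* The triangle 2, 3, 4 of the zigzag provides the two edges at the link. *)
have Ep13 : [set v1; v3] \in Ep.
  apply: (memEp _ _ 2 4); rewrite ?v1E ?v3E -?(inj_eq (@ord_inj _));
    rewrite ?v1E ?v3E //;
    by rewrite /label_plus hE /wrap_mod; split_ifs; lia.
have Ep23 : [set v2; v3] \in Ep.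
  apply: (memEp _ _ 3 4); rewrite ?v2E ?v3E -?(inj_eq (@ord_inj _));
    rewrite ?v2E ?v3E //;
    by rewrite /label_plus hE /wrap_mod; split_ifs; lia.
case: [pick x in _ | _] / (@pickP _ (fun x => (x \in polygon k.+4.+1) &&
  (([set v1; x] \in Ep) && ([set v2; x] \in Ep)))) => [x|none]; last first.
  by have := none v3; rewrite mem_polygon Ep13 Ep23.
case/and3P=> _ xEp1 /Ep2[xv1|->].
  by have := edge_image_card xEp1; rewrite xv1 setUid cards1.
by case: pickP => // y /and3P[_ yEm _]; apply: contraNneq Em13 => -[<-].
Qed.

End PairReduction.

Lemma theta_two_contractions k (v3 : 'I_k.+4.+2) (v1 : 'I_k.+4.+1) U V U' V' :
  v3 = 3 :> nat -> v1 = 1 :> nat ->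
  edge_image (@contract1 k) (edge_image (@contract3 k) U) = U' ->
  edge_image (@contract1 k) (edge_image (@contract3 k) V) = V' ->
  lk (polygon k.+4.+1) v1 (edge_image (@contract3 k) U) !=
  lk (polygon k.+4.+1) v1 (edge_image (@contract3 k) V) ->
  3 <= theta (polygon k.+4.+2) (U, V) v3 ->
  delta (polygon k.+4) (U', V') + 4 <= delta (polygon k.+4.+2) (U, V).
Proof.
move=> v3E v1E <- <- lkUV /theta_path[//|p [Up lp sp cp]].
have [p1 [Up1 lp1 sp1]] := contract3_path v3E Up lp.
have [p2 [Up2 lp2 sp2]] := contract1_path v1E Up1 lp1.
(* The ends of [p1] have different links, so the second contraction drops at least one flip beyond
   the three dropped by the first. *)
have := count_incident_gt0 lp1 lkUV; have := delta_leq_path Up2 lp2.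
move: sp sp1 sp2 cp; lia.
Qed.

Theorem theorem7 (n : nat) (v3 : 'I_n) :
  5 < n -> v3 = 3 :> nat ->
  3 <= theta (polygon n) (A n) v3 ->
  delta (polygon (n - 2)) (A (n - 2)) + 4 <= delta (polygon n) (A n).
Proof.
case: n v3 => [|[|[|[|[|[|k]]]]]] // v3 _ v3E.
have -> : k.+4.+2 - 2 = k.+4 by lia.
have v1E : (inord 1 : 'I_k.+4.+1) = 1 :> nat by rewrite inordK.
exact: (theta_two_contractions v3E v1E (contract_A_minus k)
  (contract_A_plus k) (lk_contract3 v1E)).
Qed.
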